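(* Let $G\subset\mathbf{R}^n$ be a discrete subgroup with covering projection $\pi:\mathbf{R}^n\to\mathbf{R}^n/G$. Let $g\in G$ be non-zero, let $u=\{u_1,u_2\}$ be any orthonormal pair of vectors in $\mathbf{R}^n$ perpendicular to $g$, and let $r>0$. Then the helical arc $h_{g,u}:[0,2\pi]\to\mathbf{R}^n$ given by $$h_{g,u}(t):=\frac{t}{2\pi}\,g+r\,(u_1\cos t+u_2\sin t)$$ projects (via $\pi$) to a $g$-homotopic skew loop in $\mathbf{R}^n/G$.
   Context: $G$ is a discrete additive subgroup of $\mathbf{R}^n$. A loop in $\mathbf{R}^n/G$ is a $C^1$ immersion of the circle; equivalently, a $C^1$ immersed arc $\sigma:[a,b]\to\mathbf{R}^n/G$ ($a<b$) with $\sigma(a)=\sigma(b)$ and $\dot\sigma(a)=\dot\sigma(b)$ (the endpoints $a,b$ representing the same point of the circle). All tangent spaces of $\mathbf{R}^n/G$ are identified with $\mathbf{R}^n$ by translation, so $\dot\sigma(t)\in\mathbf{R}^n$. A loop $\sigma$ in $\mathbf{R}^n/G$ is skew if it has no pair of parallel tangent lines: for distinct parameters $t_1\ne t_2$ in the circle, the tangent lines spanned by $\dot\sigma(t_1)$ and $\dot\sigma(t_2)$ never coincide under this identification. For $g\in G$, a loop in $\mathbf{R}^n/G$ is $g$-homotopic if it has the form $\pi\circ\alpha$ for an arc $\alpha:[a,b]\to\mathbf{R}^n$ with $\alpha(b)-\alpha(a)=g$. *)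

(* Defs.v *)
From HB Require Import structures.
From mathcomp Require Import all_boot all_order all_algebra.
From mathcomp Require Import all_classical all_reals all_analysis.

Set Implicit Arguments.
Unset Strict Implicit.
Unset Printing Implicit Defensive.

Import Order.TTheory GRing.Theory Num.Theory.
Import numFieldNormedType.Exports.

Local Open Scope classical_set_scope.
Local Open Scope ring_scope.

Definition dot (R : realType) (n : nat) (x y : 'rV[R]_n) : R :=
  \sum_(i < n) x 0 i * y 0 i.

Definition orthonormal_pair (R : realType) (n : nat) (u1 u2 : 'rV[R]_n) : Prop :=
  [/\ dot u1 u1 = 1, dot u2 u2 = 1 & dot u1 u2 = 0].

Definition discrete_subgroup (R : realType) (n : nat)
    (G : zmodClosed 'rV[R]_n) : Prop :=
  [set` G] `<=` isolated [set` G].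

Local Open Scope quotient_scope.

Definition quot_proj (R : realType) (n : nat) (G : zmodClosed 'rV[R]_n)
    (x : 'rV[R]_n) : Quotient.quot G :=
  \pi_(Quotient.quot G) x.

(* Arcs are functions on R of which only the restriction to [a, b] matters. *)

(* For discrete G the charts of R^n/G are the local inverses of the projection,
   so the velocity of sigma at t is the derivative at t of a lift of sigma near
   t; two such lifts differ near t by a constant element of G, so it does not
   depend on the lift. The derivative is taken within [a, b], hence it is
   one-sided at a and b. *)
Definition has_velocity (R : realType) (n : nat) (G : zmodClosed 'rV[R]_n)
    (a b : R) (sigma : R -> Quotient.quot G) (t : R) (v : 'rV[R]_n) : Prop :=
  exists alpha : R -> 'rV[R]_n,
    (\forall s \near t, s \in `[a, b] -> sigma s = quot_proj G (alpha s)) /\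
    (s - t)^-1 *: (alpha s - alpha t) @[s --> within `[a, b] t^'] --> v.

Definition velocity (R : realType) (n : nat) (G : zmodClosed 'rV[R]_n)
    (a b : R) (sigma : R -> Quotient.quot G) (t : R) : 'rV[R]_n :=
  xget 0 [set v | has_velocity a b sigma t v].

Definition C1_immersed_arc (R : realType) (n : nat) (G : zmodClosed 'rV[R]_n)
    (a b : R) (sigma : R -> Quotient.quot G) : Prop :=
  [/\ a < b,
      {in `[a, b], forall t, exists v, has_velocity a b sigma t v},
      {within `[a, b], continuous (velocity a b sigma)} &
      {in `[a, b], forall t, velocity a b sigma t != 0}].

Definition loop (R : realType) (n : nat) (G : zmodClosed 'rV[R]_n)
    (a b : R) (sigma : R -> Quotient.quot G) : Prop :=
  [/\ C1_immersed_arc a b sigma,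
      sigma a = sigma b &
      velocity a b sigma a = velocity a b sigma b].

(* Since a and b represent the same point, [a, b[ parametrizes the circle. *)
Definition skew_loop (R : realType) (n : nat) (G : zmodClosed 'rV[R]_n)
    (a b : R) (sigma : R -> Quotient.quot G) : Prop :=
  loop a b sigma /\
  {in `[a, b[ &, forall t1 t2, t1 != t2 ->
     (<[velocity a b sigma t1]> != <[velocity a b sigma t2]>)%VS}.

Definition homotopic (R : realType) (n : nat) (G : zmodClosed 'rV[R]_n)
    (g : 'rV[R]_n) (a b : R) (sigma : R -> Quotient.quot G) : Prop :=
  exists alpha : R -> 'rV[R]_n,
    [/\ {within `[a, b], continuous alpha},
        {in `[a, b], sigma =1 quot_proj G \o alpha} &
        alpha b - alpha a = g].

Definition helix (R : realType) (n : nat) (g u1 u2 : 'rV[R]_n) (r : R)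
    (t : R) : 'rV[R]_n :=
  (t / (2 * pi)) *: g + r *: (cos t *: u1 + sin t *: u2).

(* Main.v *)
Require Import Defs.
From mathcomp Require Import all_boot all_order all_algebra.
From mathcomp Require Import all_classical all_reals all_analysis.
From mathcomp Require Import lra.
Import Order.TTheory GRing.Theory Num.Theory.
Import numFieldNormedType.Exports.
Local Open Scope classical_set_scope.
Local Open Scope ring_scope.

(* A curve in R^n/G has at most one velocity at t: the difference of two lifts
   takes values in G and tends to its value at t, so it is constant near t
   because G is discrete. Hence the velocity of the projected helix is
   g/2pi + r(-sin t u1 + cos t u2). Its component along g is constant and
   non-zero, so parallel velocities are equal, and then their components along
   u1 and u2 determine t modulo 2pi. *)

(** * Inner product on row vectors *)

Section dot_product.
Context {R : realType} {n : nat}.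
Implicit Types x y z : 'rV[R]_n.

Lemma dotC x y : dot x y = dot y x.
Proof. by apply: eq_bigr => i _; rewrite mulrC. Qed.

Lemma dotDl x y z : dot (x + y) z = dot x z + dot y z.
Proof. by rewrite -big_split; apply: eq_bigr => i _; rewrite mxE mulrDl. Qed.

Lemma dotZl c x y : dot (c *: x) y = c * dot x y.
Proof. by rewrite mulr_sumr; apply: eq_bigr => i _; rewrite mxE mulrA. Qed.

Lemma dot_self_eq0 x : (dot x x == 0) = (x == 0).
Proof.
rewrite psumr_eq0 => [|i _]; last by rewrite -expr2 sqr_ge0.
apply/allP/eqP => [x0|-> i _]; last by rewrite /= mxE mulr0.
apply/rowP => i; rewrite mxE; apply/eqP.
by have := x0 i (mem_index_enum i); rewrite /= mulf_eq0 orbb.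
Qed.

End dot_product.

(** * Derivatives of vector-valued functions of a real variable *)

Section derivatives.
Context {R : realType} {V : normedModType R}.

Lemma is_derive_scalev (f : R -> R) (t df : R) (u : V) :
  is_derive t 1 f df -> is_derive t 1 (fun s => f s *: u) (df *: u).
Proof.
move=> [derf <-].
have cvg_u : h^-1 *: (((fun s => f s *: u) \o shift t) (h *: 1)
    - f t *: u) @[h --> 0^'] --> 'D_1 f t *: u.
  apply: cvg_trans (cvgZr_tmp (a := u) derf); apply: near_eq_cvg.
  by apply: nearW => h /=; rewrite -scalerBl scalerA.
apply: DeriveDef; first by apply/cvg_ex; exists ('D_1 f t *: u).
exact/cvg_lim.
Qed.

(** The substitution [h = s - t] turns the increment quotient behind [is_derive] into the quotient
    used by [has_velocity]. *)
Lemma is_derive_cvg (f : R -> V) (t : R) (df : V) : is_derive t 1 f df ->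
  (s - t)^-1 *: (f s - f t) @[s --> t^'] --> df.
Proof.
move=> [derf <-].
have shift_t : s - t @[s --> t^'] --> 0^'.
  move=> A A0; have t0 : s - t @[s --> t] --> (0 : R).
    rewrite -[X in _ --> X](subrr t).
    by apply: cvgB; [exact: cvg_id|exact: cvg_cst].
  have : \forall s \near t, s - t != 0 -> A (s - t) by exact: t0 _ A0.
  apply: filterS => s As st.
  by apply: As; rewrite subr_eq0.
have {derf} : h^-1 *: (f (h *: 1 + t) - f t) @[h --> 0^'] --> 'D_1 f t.
  exact: derf.
move=> /(cvg_comp _ _ shift_t); apply: cvg_trans; apply: near_eq_cvg.
by apply: nearW => s /=; rewrite -[(s - t)%:A]/((s - t) * 1) mulr1 subrK.
Qed.

End derivatives.

(** * Velocities of curves in the quotient *)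

Section loops.
Context {R : realType} {n : nat} {G : zmodClosed 'rV[R]_n}.
Implicit Types (a b t : R) (v w : 'rV[R]_n).

(** Since [a < b], points of the interval accumulate at [t]: from the left if [t = b], from the
    right otherwise. Properness is what makes limits along this filter unique. *)
Lemma within_itv_dnbhs_proper a b t : a < b -> t \in `[a, b] ->
  ProperFilter (within `[a, b] t^').
Proof.
move=> ab; rewrite in_itv /= => /andP[at_ tb].
split; last exact: within_filter.
move=> noA.
have {}noA : \forall s \near t, s != t -> ~ `[a, b]%classic s by exact: noA.
move: tb; rewrite le_eqVlt => /predU1P[tb|tb].
- have lat : a < t by rewrite tb.
  have : \forall s \near t^'-, False.
    near=> s; have : s != t -> ~ `[a, b]%classic s.
      by near: s; apply: (cvg_within) noA.
    rewrite /= in_itv/=; apply.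
      by rewrite lt_eqF//; near: s; exact: nbhs_left_lt.
    apply/andP; split; first by near: s; exact: nbhs_left_ge.
    by rewrite -tb; near: s; exact: nbhs_left_le.
  by move/filter_ex => [].
- have : \forall s \near t^'+, False.
    near=> s; have : s != t -> ~ `[a, b]%classic s.
      by near: s; apply: (cvg_within) noA.
    rewrite /= in_itv/=; apply.
      by rewrite gt_eqF//; near: s; exact: nbhs_right_gt.
    apply/andP; split; last by near: s; exact: nbhs_right_le.
    by rewrite (le_trans at_)//; near: s; exact: nbhs_right_ge.
  by move/filter_ex => [].
Unshelve. all: by end_near. Qed.

Lemma quot_proj_eq (x y : 'rV[R]_n) :
  (quot_proj G x = quot_proj G y) <-> (x - y \in G).
Proof. by rewrite Quotient.idealrBE; split=> [/eqP|/eqP]. Qed.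

Lemma has_velocity_unique a b (sigma : R -> Quotient.quot G) t v w :
  discrete_subgroup G -> a < b -> t \in `[a, b] ->
  has_velocity a b sigma t v -> has_velocity a b sigma t w -> v = w.
Proof.
move=> discG ab tab [alpha [lift_alpha alphav]] [beta [lift_beta betaw]].
pose F := within `[a, b] t^'.
have FF : ProperFilter F by exact: within_itv_dnbhs_proper.
have F_t : F --> nbhs t.
  by move=> A tA; apply: cvg_within; exact: nbhs_dnbhs.
(* A convergent difference quotient forces continuity at [t] along [F]: multiplied by [s - t] it
   tends to 0. *)
have cont (f : R -> 'rV[R]_n) (u : 'rV[R]_n) :
    (s - t)^-1 *: (f s - f t) @[s --> F] --> u -> f s @[s --> F] --> f t.
  move=> fu.
  have : (s - t) *: ((s - t)^-1 *: (f s - f t)) + f t @[s --> F] -->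
      (t - t) *: u + f t.
    apply: cvgD; last exact: cvg_cst.
    apply: cvgZ => //; apply: cvgB; last exact: cvg_cst.
    exact: F_t.
  rewrite subrr scale0r add0r; apply: cvg_trans; apply: near_eq_cvg.
  rewrite /F; near=> s.
  rewrite scalerA divff ?scale1r ?subrK// subr_eq0.
  by near: s; apply: cvg_within; exact: withinT.
pose delta s := alpha s - beta s.
have delta_cvg : delta s @[s --> F] --> delta t.
  by apply: cvgB; [exact: cont alphav|exact: cont betaw].
have deltaG : \forall s \near t, s \in `[a, b] -> delta s \in G.
  near=> s => sab; apply/quot_proj_eq.
  by transitivity (sigma s); [symmetry|]; move: sab; near: s.
(* [deltaG] holds on a full neighbourhood, so it applies at [t] itself: [delta t] is a point of [G],
   and some neighbourhood [U] of it meets [G] only there. *)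
have := discG (delta t) (nbhs_singleton deltaG tab).
move=> [_ [U Ut UG]].
have delta_eq : \forall s \near F, delta s = delta t.
  near=> s.
  suff : (U `&` [set` G]) (delta s) by rewrite UG.
  split; first by near: s; exact: delta_cvg.
  have sab : s \in `[a, b] by near: s; exact: withinT.
  by move: sab; rewrite /=; near: s; exact: F_t.
(* With [delta] constant along [F], both lifts have the same difference quotients there, hence the
   same limit. *)
apply: (@cvg_unique _ (@norm_hausdorff _ _) _ _ _ _ alphav).
apply: cvg_trans betaw; apply: near_eq_cvg; near=> s.
congr (_ *: _).
have : delta s = delta t by near: s.
rewrite /delta => delta_st; apply/eqP; rewrite -subr_eq0 opprD addrACA -opprD.
by rewrite -[beta s - _]opprB delta_st opprB subrr.
Unshelve. all: by end_near. Qed.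

(** The vector chosen by [xget] is a velocity because one exists, so the default 0 is not taken by
    fallback; uniqueness then identifies it with [v]. *)
Lemma velocityE a b (sigma : R -> Quotient.quot G) t v :
  discrete_subgroup G -> a < b -> t \in `[a, b] ->
  has_velocity a b sigma t v -> velocity a b sigma t = v.
Proof.
move=> discG ab tab sv; apply: has_velocity_unique (sv) => //.
by apply: (xgetPex 0); exists v.
Qed.

(** [alpha] is itself a lift, and its two-sided derivative restricts to the limit within the
    interval. *)
Lemma lift_has_velocity a b (alpha : R -> 'rV[R]_n) t v :
  is_derive t 1 alpha v -> has_velocity a b (quot_proj G \o alpha) t v.
Proof.
move=> /is_derive_cvg alphav; exists alpha; split; first by near=> s.
exact: cvg_trans (cvg_app _ (cvg_within _)) alphav.
Unshelve. all: by end_near. Qed.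

End loops.

(** If both coordinates agree, the cosine of the difference is a sum of squares equal to 1, which is
    impossible strictly between 0 and [2 * pi]. *)
Lemma cos_sin_inj {R : realType} :
  {in `[0, 2 * pi[ &, forall t1 t2 : R,
     cos t1 = cos t2 -> sin t1 = sin t2 -> t1 = t2}.
Proof.
suff cos_eq1 (x : R) : 0 < x < 2 * pi -> cos x <> 1.
  move=> t1 t2; rewrite !in_itv/= => /andP[t1_ge0 t1_lt] /andP[t2_ge0 t2_lt].
  move=> cosE sinE; apply/eqP; apply: contraT; rewrite neq_lt => /orP[] lt_t.
  - case: (cos_eq1 (t2 - t1)); first by apply/andP; split; lra.
    by rewrite cosB cosE sinE -!expr2 cos2Dsin2.
  - case: (cos_eq1 (t1 - t2)); first by apply/andP; split; lra.
    by rewrite cosB cosE sinE -!expr2 cos2Dsin2.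
move=> /andP[x_gt0 x_lt].
(* Half-angle formula: [cos x = 1] would force [sin (x / 2) = 0], yet [x / 2] lies strictly between
   0 and [pi]. *)
have : 0 < sin (x / 2) by apply: sin_gt0_pi; apply/andP; split; lra.
move=> s0; have -> : x = (x / 2) *+ 2 by rewrite -mulr_natr; lra.
rewrite cos_mulr2n cos2sin2 => H.
have : sin (x / 2) ^+ 2 = 0 by lra.
by move/eqP; rewrite sqrf_eq0 gt_eqF.
Qed.

(** * Velocity and tangent lines of the helix *)

Section helices.
Context {R : realType} {n : nat}.
Context (g u1 u2 : 'rV[R]_n) (r : R).

Definition helix_velocity (t : R) : 'rV[R]_n :=
  (2 * pi)^-1 *: g + r *: (- sin t *: u1 + cos t *: u2).

Lemma is_derive_helix (t : R) :
  is_derive t 1 (helix g u1 u2 r) (helix_velocity t).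
Proof.
apply: is_deriveD.
  apply: is_derive_scalev.
  have := is_deriveZ (2 * pi)^-1 (is_derive_id t (1 : R)).
  rewrite [_%:A]mulr1 (_ : _ \*: _ = fun s => s / (2 * pi))//.
  by apply/funext => s; exact: mulrC.
by apply: is_deriveZ; apply: is_deriveD; exact: is_derive_scalev.
Qed.

Lemma continuous_helix : continuous (helix g u1 u2 r).
Proof.
move=> t; apply/differentiable_continuous/derivable1_diffP.
by case: (is_derive_helix t).
Qed.

Lemma continuous_helix_velocity : continuous helix_velocity.
Proof.
move=> t; apply: cvgD; first exact: cvg_cst.
apply: cvgZl_tmp; apply: cvgD; apply: cvgZr_tmp; last exact: continuous_cos.
by apply: cvgN; exact: continuous_sin.
Qed.

(** The circular part is periodic, so only the drift along [g] survives. This both closes the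
    projected arc and gives its homotopy class. *)
Lemma helixD2pi : helix g u1 u2 r (2 * pi) - helix g u1 u2 r 0 = g.
Proof.
have pi0 : 2 * pi != 0 :> R by rewrite mulf_neq0// gt_eqF// pi_gt0.
rewrite /helix divff // mul0r scale1r scale0r add0r.
by rewrite [2 * pi]mulr_natl cos2pi sin2pi cos0 sin0 addrK.
Qed.

Lemma helix_velocity2pi : helix_velocity (2 * pi) = helix_velocity 0.
Proof.
by rewrite /helix_velocity [2 * pi]mulr_natl cos2pi sin2pi cos0 sin0.
Qed.

Context (g_neq0 : g != 0) (u_orthonormal : orthonormal_pair u1 u2).
Context (u1_perp_g : dot u1 g = 0) (u2_perp_g : dot u2 g = 0).

Lemma dot_helix_velocity_axis (t : R) :
  dot (helix_velocity t) g = (2 * pi)^-1 * dot g g.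
Proof.
by rewrite dotDl !dotZl dotDl !dotZl u1_perp_g u2_perp_g !(mulr0, addr0).
Qed.

Lemma dot_helix_velocity_u1 (t : R) : dot (helix_velocity t) u1 = - (r * sin t).
Proof.
case: u_orthonormal => u11 u22 u12.
rewrite dotDl !dotZl dotDl !dotZl (dotC g) u1_perp_g u11 (dotC u2) u12.
by rewrite !(mulr0, addr0, add0r, mulr1) mulrN.
Qed.

Lemma dot_helix_velocity_u2 (t : R) : dot (helix_velocity t) u2 = r * cos t.
Proof.
case: u_orthonormal => u11 u22 u12.
rewrite dotDl !dotZl dotDl !dotZl (dotC g) u2_perp_g u22 u12.
by rewrite !(mulr0, addr0, add0r, mulr1).
Qed.

Lemma dot_helix_velocity_axis_neq0 (t : R) : dot (helix_velocity t) g != 0.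
Proof.
rewrite dot_helix_velocity_axis mulf_neq0 ?dot_self_eq0//.
by rewrite invr_eq0 mulf_neq0// gt_eqF// pi_gt0.
Qed.

Lemma helix_velocity_neq0 (t : R) : helix_velocity t != 0.
Proof.
apply: contra_neq (dot_helix_velocity_axis_neq0 t) => ->.
by rewrite -(scale0r 0) dotZl mul0r.
Qed.

Lemma helix_tangent_lines_neq (t1 t2 : R) : 0 < r ->
  t1 \in `[0, 2 * pi[ -> t2 \in `[0, 2 * pi[ -> t1 != t2 ->
  (<[helix_velocity t1]> != <[helix_velocity t2]>)%VS.
Proof.
move=> r_gt0 t1_in t2_in; apply: contra_neq => line_eq.
have /vlineP[k vk] : helix_velocity t1 \in <[helix_velocity t2]>%VS.
  by rewrite -line_eq memv_line.
(* The g-component of the velocity is constant and non-zero, so k = 1. *)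
have k1 : k = 1.
  apply: (mulIf (dot_helix_velocity_axis_neq0 t2)).
  by rewrite -dotZl -vk mul1r !dot_helix_velocity_axis.
move: vk; rewrite k1 scale1r => vE.
(* The components along [u2] and [u1] are [r * cos t] and [- (r * sin t)]; cancelling [r] recovers
   the cosine and sine. *)
apply: cos_sin_inj => //; apply: (mulfI (lt0r_neq0 r_gt0)).
  by rewrite -!dot_helix_velocity_u2 vE.
by apply: oppr_inj; rewrite -!dot_helix_velocity_u1 vE.
Qed.

End helices.

Theorem proposition2p2 (R : realType) (n : nat) (G : zmodClosed 'rV[R]_n)
    (discG : discrete_subgroup G)
    (g : 'rV[R]_n) (gG : g \in G) (g_neq0 : g != 0)
    (u1 u2 : 'rV[R]_n) (u_orthonormal : orthonormal_pair u1 u2)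
    (u1_perp_g : dot u1 g = 0) (u2_perp_g : dot u2 g = 0)
    (r : R) (r_gt0 : 0 < r) :
  skew_loop 0 (2 * pi) (quot_proj G \o helix g u1 u2 r) /\
  homotopic g 0 (2 * pi) (quot_proj G \o helix g u1 u2 r).
Proof.
have pi2_gt0 : 0 < 2 * pi :> R by rewrite mulr_gt0// pi_gt0.
set sigma := quot_proj G \o helix g u1 u2 r.
have sigma_vel t : has_velocity 0 (2 * pi) sigma t (helix_velocity g u1 u2 r t).
  by apply: lift_has_velocity; exact: is_derive_helix.
have velE : {in `[0, 2 * pi],
    velocity 0 (2 * pi) sigma =1 helix_velocity g u1 u2 r}.
  by move=> t t_in; exact: velocityE.
have in0 : (0 : R) \in `[0, 2 * pi] by rewrite bound_itvE ltW.
have in2pi : (2 * pi : R) \in `[0, 2 * pi] by rewrite bound_itvE ltW.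
split; last first.
  exists (helix g u1 u2 r); split=> //; last exact: helixD2pi.
  exact/continuous_subspaceT/continuous_helix.
split; last first.
  move=> t1 t2 t1_in t2_in t12; rewrite !velE ?subset_itv_co_cc//.
  exact: helix_tangent_lines_neq.
split; last first.
- by rewrite !velE// helix_velocity2pi.
(* The endpoints of the lift differ by [g], which lies in [G]. *)
- by symmetry; apply/quot_proj_eq; rewrite helixD2pi.
split=> //.
- by move=> t _; exists (helix_velocity g u1 u2 r t).
(* The explicit formula for the velocity is known only on the closed interval, so continuity is
   transferred in the subspace topology. *)
- apply: (@subspace_eq_continuous _ _ _ (helix_velocity g u1 u2 r)).
    by move=> t /set_mem t_in; symmetry; exact: velE.
  exact/continuous_subspaceT/continuous_helix_velocity.
- by move=> t t_in; rewrite velE// helix_velocity_neq0.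
Qed.
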